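(* Let $G$ be a $\mathfrak{C}'$-cofinite group and let $H\leq Z(G)$ be a subgroup of the center of $G$. Then the quotient group $G/H$ is $\mathfrak{C}'$-cofinite.
   Context: For a group $G$, $\mathfrak{C}'_G$ is the topology on $G$ having as a subbase of its closed sets all singletons together with all cosets $hC_G(g)$, $g,h\in G$, where $C_G(g)$ is the centralizer of $g$ in $G$. $G$ is $\mathfrak{C}'$-cofinite if $\mathfrak{C}'_G$ is the cofinite topology on $G$ (closed sets: $G$ and the finite subsets of $G$). *)

(* Defs.v *)
From HB Require Import structures.
From mathcomp Require Import all_boot.
From mathcomp Require Import all_classical topology.

Set Implicit Arguments.
Unset Strict Implicit.
Unset Printing Implicit Defensive.

Local Open Scope classical_set_scope.
Local Open Scope group_scope.
Local Open Scope quotient_scope.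

Section Centralizers.
Variable G : groupType.

Definition centralizer (g : G) : set G := [set x | commute x g].

Definition center : set G := [set x | forall y, commute x y].

Definition left_coset (h : G) (A : set G) : set G := [set h * x | x in A].

Definition Cprime_subbase : set (set G) :=
  [set A | (exists x, A = [set x]) \/
           (exists h g, A = left_coset h (centralizer g))].

End Centralizers.

Arguments center G : clear implicits.
Arguments Cprime_subbase G : clear implicits.

(* A copy of the carrier of G, bearing the topology whose open sets are
   generated by the complements of the members of Cprime_subbase. *)
Definition Cprime_space (G : groupType) : Type := G.

HB.instance Definition _ (G : groupType) := Choice.on (Cprime_space G).
HB.instance Definition _ (G : groupType) :=
  isSubBaseTopological.Build (Cprime_space G)
    [set ~` A | A in Cprime_subbase G] id.

Definition Cprime_cofinite (G : groupType) : Prop :=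
  forall A : set (Cprime_space G), closed A <-> A = setT \/ finite_set A.

Section Quotient.
Variables (G : groupType) (H : groupClosed G).

Definition normal_subgroup : Prop := forall x y : G, x \in H -> x ^ y \in H.

Lemma central_normal : [set` H] `<=` center G -> normal_subgroup.
Proof.
by move=> sHZ x y xH; rewrite /conjg (sHZ x xH y) mulKg.
Qed.

Definition coset_rel : rel G := fun x y => x^-1 * y \in H.

Lemma coset_rel_equiv : equiv_class_of coset_rel.
Proof.
split=> [x|x y|y x z]; rewrite /coset_rel.
- by rewrite mulVg gpred1.
- by rewrite -(gpredV H) invgM invgK.
- by move=> xy yz; rewrite -(mulVKg y z) mulgA gpredM.
Qed.

Canonical coset_equiv := EquivRelPack coset_rel_equiv.

End Quotient.

(* The carrier does not depend on nH, but recording it in the type lets the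
   group structure be inferred. *)
Definition quotient_group (G : groupType) (H : groupClosed G)
  (nH : normal_subgroup H) : Type := {eq_quot coset_rel H}.

Section QuotientGroup.
Variables (G : groupType) (H : groupClosed G) (nH : normal_subgroup H).
Local Notation Q := (quotient_group nH).

HB.instance Definition _ := Choice.on Q.
HB.instance Definition _ := EqQuotient.on Q.

Lemma quotient_eqP (x y : G) : reflect (x = y %[mod Q]) (x^-1 * y \in H).
Proof. exact: (@eqquotP _ (coset_rel H) Q). Qed.

Definition quotient_one : Q := \pi_Q 1.
Definition quotient_inv (a : Q) : Q := \pi_Q (repr a)^-1.
Definition quotient_mul (a b : Q) : Q := \pi_Q (repr a * repr b).

Lemma quotient_pi_inv (x : G) : quotient_inv (\pi_Q x) = \pi_Q x^-1.
Proof.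
rewrite /quotient_inv; case: (piP Q x) => y /quotient_eqP xy.
apply/quotient_eqP; rewrite invgK.
by have := nH x^-1 xy; rewrite /conjg invgK -mulgA mulVKg.
Qed.

Lemma quotient_pi_mul (x y : G) :
  quotient_mul (\pi_Q x) (\pi_Q y) = \pi_Q (x * y).
Proof.
rewrite /quotient_mul.
case: (piP Q x) => x' /quotient_eqP xx'; case: (piP Q y) => y' /quotient_eqP yy'.
apply/esym/quotient_eqP.
have -> : (x * y)^-1 * (x' * y') = (x^-1 * x') ^ y * (y^-1 * y').
  by rewrite /conjg invgM !mulgA mulgK.
exact: gpredM _ _ (nH y xx') yy'.
Qed.

Lemma quotient_mulA : associative quotient_mul.
Proof.
move=> a b c; rewrite -[a]reprK -[b]reprK -[c]reprK.
rewrite (quotient_pi_mul (repr b) (repr c)) (quotient_pi_mul (repr a) (repr b)).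
by rewrite !quotient_pi_mul mulgA.
Qed.

Lemma quotient_mul1 : left_id quotient_one quotient_mul.
Proof. by move=> a; rewrite -[a]reprK quotient_pi_mul mul1g. Qed.

Lemma quotient_mulr1 : right_id quotient_one quotient_mul.
Proof. by move=> a; rewrite -[a]reprK quotient_pi_mul mulg1. Qed.

Lemma quotient_mulV : left_inverse quotient_one quotient_inv quotient_mul.
Proof.
by move=> a; rewrite -[a]reprK quotient_pi_inv quotient_pi_mul mulVg.
Qed.

Lemma quotient_mulrV : right_inverse quotient_one quotient_inv quotient_mul.
Proof.
by move=> a; rewrite -[a]reprK quotient_pi_inv quotient_pi_mul mulgV.
Qed.

HB.instance Definition _ := isGroup.Build Q quotient_mulA quotient_mul1
  quotient_mulr1 quotient_mulV quotient_mulrV.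

Lemma quotient_piM (x y : G) : \pi_Q (x * y) = \pi_Q x * \pi_Q y.
Proof. exact/esym/quotient_pi_mul. Qed.

End QuotientGroup.

(* Main.v *)
Require Import Defs.
From mathcomp Require Import all_boot finmap.
From mathcomp Require Import all_classical topology.

(** A group is C'-cofinite exactly when each of its centralizers is either
    finite or the whole group ([Cprime_cofiniteP]), so it suffices to examine
    the centralizer of a coset [gH] in [G / H]. It is the image of
    [K = {x | g^-1 * g ^ x \in H}], the set of the [x] for which [g ^ x] lies in
    [g H] ([commute_quotient_pi]). If [g] is central, then [K = G] and the
    centralizer of [gH] is [G / H]. Otherwise [C_G(g)] is finite; as [H] is
    central it is contained in [C_G(g)], so [H] and [g H] are finite too. The
    fibres of [x |-> g ^ x] are right cosets of [C_G(g)], so [K] consists of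
    finitely many finite fibres ([finite_conj_preimage]), and its image in
    [G / H] is finite. *)

Local Open Scope classical_set_scope.

Section CofiniteCriterion.
Local Open Scope group_scope.
Variable G : groupType.

Lemma Cprime_openE :
  @open (Cprime_space G) =
  [set \bigcup_(U in F) U | F in
    [set F | F `<=` finI_from [set ~` A | A in Cprime_subbase G] id]].
Proof. by []. Qed.

Lemma Cprime_subbase_closed (A : set (Cprime_space G)) :
  Cprime_subbase G A -> closed A.
Proof.
move=> sA; rewrite -openC Cprime_openE.
exists [set ~` A]; last by rewrite bigcup_set1.
move=> _ ->; exists [fset ~` A]%fset; last by rewrite set_fset1 bigcap_set1.
by move=> B /fset1P ->; rewrite inE; exists A.
Qed.

Lemma Cprime_finite_closed (A : set (Cprime_space G)) :
  finite_set A -> closed A.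
Proof.
move=> finA; rewrite -[A]image_id -bigcup_imset1.
by apply: closed_bigcup => // x _; apply: Cprime_subbase_closed; left; exists x.
Qed.

(** Being everything or finite passes from the subbase to all closed sets: a
    proper closed set misses some point, hence lies in a finite union of
    subbasic closed sets missing that point; none of these is everything, so
    they are all finite. *)
Lemma Cprime_closed_finite (A : set (Cprime_space G)) :
  (forall B, Cprime_subbase G B -> B = setT \/ finite_set B) ->
  closed A -> A = setT \/ finite_set A.
Proof.
move=> sub; have [-> _|/eqP AT clA] := pselect (A = setT); first by left.
right; have [x Ax] : ~` A !=set0.
  by apply/set0P; apply: contra AT => /eqP A0; rewrite -[A]setCK A0 setC0.
have : open (~` A) by rewrite openC.
rewrite Cprime_openE => -[F FB UF].
move: Ax; rewrite -UF => -[U FU Ux].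
have [D DB UE] := FB _ FU.
have sAD : A `<=` \bigcup_(V in [set` D]) ~` V.
  move=> y Ay; apply: contrapT => nDy; suff : (~` A) y by [].
  rewrite -UF; exists U => //; rewrite -UE => V DV.
  by apply: contrapT => nVy; apply: nDy; exists V.
apply: sub_finite_set sAD _; apply: bigcup_finite => // V DV.
have /set_mem [B sB VE] := DB V DV.
have Vx : V x by move: Ux; rewrite -UE; apply.
rewrite -VE setCK; case: (sub B sB) => // BT.
by move: Vx; rewrite -VE BT setCT.
Qed.

(** Cosets of a centralizer are finite, or everything, together with it. *)
Lemma Cprime_cofiniteP :
  Cprime_cofinite G <->
  forall g : G, centralizer g = setT \/ finite_set (centralizer g).
Proof.
split=> [cofG g|cent A].
  apply/cofG; apply: Cprime_subbase_closed; right; exists 1, g.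
  by rewrite /left_coset eq_image_id // => x _; exact: mul1g.
split; last by case=> [->|/Cprime_finite_closed]; [exact: closedT|].
apply: Cprime_closed_finite => B [[x ->]|[h [g ->]]].
  by right; apply: finite_set1.
case: (cent g) => [->|fing]; last by right; apply: finite_image.
by left; apply/seteqP; split=> // y _; exists (h^-1 * y); rewrite ?mulVKg.
Qed.

(** Each nonempty fibre of [x |-> g ^ x] is a right coset of the centralizer
    of [g]. *)
Lemma finite_conj_preimage (g : G) (B : set G) :
  finite_set (centralizer g) -> finite_set B -> finite_set [set x | B (g ^ x)].
Proof.
move=> finC finB.
have -> : [set x | B (g ^ x)] = \bigcup_(b in B) [set x | g ^ x = b].
  by apply/seteqP; split=> [x Bx|x [b Bb /= ->]] //; exists (g ^ x).
apply: bigcup_finite => // b _.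
have [[y yb]|nob] := pselect (exists y, g ^ y = b); last first.
  by apply: sub_finite_set (finite_set0 _) => x xb; apply: nob; exists x.
apply: sub_finite_set (finite_image (fun c => c * y) finC) => x /= xb.
exists (x * y^-1); last exact: mulgVK.
apply/esym/commgP/conjg_fixP.
by rewrite conjgM xb -yb -conjgM mulgV conjg1.
Qed.

End CofiniteCriterion.

Lemma commute_quotient_pi (G : groupType) (H : groupClosed G)
    (nH : normal_subgroup H) (x g : G) :
  commute (\pi_(quotient_group nH) x)%qT (\pi_(quotient_group nH) g)%qT <->
  (g^-1 * g ^ x)%g \in H.
Proof.
have -> : (g^-1 * g ^ x = (x * g)^-1 * (g * x))%g.
  by rewrite /conjg invgM !mulgA.
by rewrite /commute -!quotient_piM; split=> /(quotient_eqP nH).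
Qed.

Theorem lemma5p14 (G : groupType) (H : groupClosed G)
    (sHZ : [set` H] `<=` center G) :
  Cprime_cofinite G -> Cprime_cofinite (quotient_group (central_normal sHZ)).
Proof.
move=> /Cprime_cofiniteP cofG; apply/Cprime_cofiniteP => a.
rewrite -[a]reprK; set g : G := repr a.
have [CT|finC] := cofG g.
  left; apply/seteqP; split=> // b _; rewrite /centralizer /= -[b]reprK.
  apply/commute_quotient_pi.
  have /esym/commgP/conjg_fixP-> : centralizer g (repr b) by rewrite CT.
  by rewrite mulVg gpred1.
right.
have finH : finite_set [set` H] by apply: sub_finite_set finC => h /sHZ; apply.
have finK := finite_conj_preimage _ _ _ finC
  (finite_image (fun h => g * h)%g finH).
apply: sub_finite_set (finite_image \pi_(quotient_group _)%qT finK) => b.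
rewrite /centralizer /= -[b]reprK => /commute_quotient_pi bH.
by exists (repr b) => //=; exists (g^-1 * g ^ repr b)%g => //; exact: mulVKg.
Qed.
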